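(* Let $\{G_n\}$ and $\{H_n\}$ be two sequences of finite simple graphs with $\mathcal E(G_n)>0$ for all sufficiently large $n$, such that $$\lim_{n\rightarrow \infty}\frac{\Delta(G_n,H_n)}{\mathcal E(G_n)}=0.$$ Then $$\lim_{n\rightarrow \infty}\frac{\mathcal E(H_n)}{\mathcal E(G_n)}=1.$$
   Context: For a finite simple graph $G$ with adjacency matrix $A(G)$, the energy $\mathcal E(G)$ is the sum of the absolute values of all eigenvalues of $A(G)$ (counted with multiplicity). For two graphs $G$ and $H$ (whose vertex sets need not coincide), $\Delta(G,H)=|E(G)|+|E(H)|-2|E(G)\cap E(H)|$, i.e. the number of edges in the symmetric difference of $E(G)$ and $E(H)$. *)

(* Defs.v *)
From HB Require Import structures.
From mathcomp Require Import all_boot all_order all_algebra.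
From mathcomp Require Import finmap.
From mathcomp Require Import complex.
From mathcomp Require Import all_classical all_reals all_analysis.

Set Implicit Arguments.
Unset Strict Implicit.
Unset Printing Implicit Defensive.

Import Order.TTheory GRing.Theory Num.Theory.

Local Open Scope ring_scope.

(* All vertices live in a common universe [U], so that the edge sets of two
   graphs with different vertex sets can be intersected. An edge is the
   two-element set of its endpoints. *)
Record sgraph (U : choiceType) := SGraph {
  vertices : {fset U};
  edges : {fset {fset U}};
  edges_subset : forall e, e \in edges -> (e `<=` vertices)%fset;
  edges_card2 : forall e, e \in edges -> #|` e| = 2%N
}.

(* Rows and columns follow the enumeration of the finite type [vertices G].
   For [x = y] the set [fset x; x] is a singleton, hence not an edge. *)
Definition adjacency (K : pzRingType) (U : choiceType) (G : sgraph U) :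
    'M[K]_#|{: vertices G}| :=
  \matrix_(i, j)
    ([fset val (enum_val i); val (enum_val j)]%fset \in edges G)%:R.

(* The roots of the characteristic polynomial, repeated according to their
   multiplicity. *)
Definition eigenvalues (C : closedFieldType) (n : nat) (A : 'M[C]_n) : seq C :=
  sval (closed_field_poly_normal (char_poly A)).

(* [complex.Re `|z|] is the modulus of [z] as an element of [R]: the norm of
   [R[i]] takes its values in [R[i]]. *)
Definition energy (R : realType) (U : choiceType) (G : sgraph U) : R :=
  \sum_(z <- eigenvalues (adjacency R[i] G)) complex.Re `|z|.

Definition edge_dist (U : choiceType) (G H : sgraph U) : int :=
  #|` edges G|%:Z + #|` edges H|%:Z - 2 * #|` (edges G `&` edges H)%fset|%:Z.

(* Main.v *)
(* The energy is the nuclear norm of the adjacency matrix: [energy H] is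
   [\tr (B *m V)] for [B] the adjacency matrix of [H] and some unitary [V].
   Let [P] be the 0-1 matrix identifying the common vertices of [G] and [H],
   and [A] the adjacency matrix of [G]. Since [P^t* *m V *m P] is a contraction,
   [P *m A *m P^t*] contributes at most [energy G] to this trace. The entries of
   [V] have modulus at most 1 and each edge of the symmetric difference accounts
   for at most two nonzero entries of [B - P *m A *m P^t*], so the rest
   contributes at most twice the edge distance. By symmetry,
   [|energy H - energy G| <= 2 * edge_dist G H]; divide by [energy G]. *)
Require Import Defs.
From HB Require Import structures.
From mathcomp Require Import all_boot all_order all_algebra.
From mathcomp Require Import finmap.
From mathcomp Require Import complex zify.
From mathcomp Require Import all_classical all_reals all_analysis.

Import Order.TTheory GRing.Theory Num.Theory.
Import numFieldNormedType.Exports.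

Local Open Scope classical_set_scope.
Local Open Scope ring_scope.

(** * Eigenvalue sums of normal matrices as traces *)

Section NuclearNorm.
Local Open Scope sesquilinear_scope.
Context {C : numClosedFieldType}.

Lemma diag_mul_trmxC m n (W : 'M[C]_(m, n)) i :
  (W *m W^t*) i i = \sum_j `|W i j| ^+ 2.
Proof. by rewrite mxE; apply: eq_bigr => j _; rewrite !mxE -normCK. Qed.

Lemma unitarymx_row_norm m n (V : 'M[C]_(m, n)) i :
  V \is unitarymx -> \sum_j `|V i j| ^+ 2 = 1.
Proof. by move/unitarymxP => VV; rewrite -diag_mul_trmxC VV mxE eqxx. Qed.

Lemma unitarymx_entry_le1 m n (V : 'M[C]_(m, n)) i j :
  V \is unitarymx -> `|V i j| <= 1.
Proof.
move=> Vu; rewrite -(@expr_le1 _ 2)// -(unitarymx_row_norm _ _ V i Vu).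
by rewrite (bigD1 j)//= lerDl sumr_ge0// => k _; rewrite exprn_ge0.
Qed.

Lemma char_poly_conj n (P M : 'M[C]_n) : P \in unitmx ->
  char_poly (invmx P *m M *m P) = char_poly M.
Proof.
move=> Pu; pose p (N : 'M[C]_n) := map_mx polyC N.
have PP : p (invmx P) *m p P = 1%:M by rewrite -map_mxM mulVmx// map_mx1.
have -> : char_poly (invmx P *m M *m P)
    = \det (p (invmx P) *m char_poly_mx M *m p P).
  congr (\det _); rewrite /char_poly_mx !map_mxM mulmxBr mulmxBl.
  by rewrite mul_mx_scalar -scalemxAl PP scalemx1.
by rewrite !det_mulmx mulrAC -det_mulmx PP det1 mul1r.
Qed.

Lemma diag_mx_unitary n (s : 'rV[C]_n) :
  (forall k, `|s 0 k| = 1) -> diag_mx s \is unitarymx.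
Proof.
move=> s1; apply/unitarymxP; apply/matrixP => i j.
rewrite mul_diag_mx !mxE; case: (altP (i =P j)) => [->|ij].
  by rewrite eqxx mulr1n -normCK s1 expr1n.
by rewrite eq_sym (negbTE ij) mulr0n conjC0 mulr0.
Qed.

(** Both sequences split the same characteristic polynomial into linear factors. Its roots are
    determined only up to order, hence [perm_eq]. *)
Lemma perm_eigenvalues_spectral n (A : 'M[C]_n) : A \is normalmx ->
  perm_eq (eigenvalues A) [seq spectral_diag A 0 k | k : 'I_n].
Proof.
move=> /orthomx_spectralP A_eq; apply: prod_XsubC_eq.
have Pu : spectralmx A \in unitmx := spectral_unit A.
have -> : \prod_(z <- eigenvalues A) ('X - z%:P) = char_poly A.
  rewrite /eigenvalues; case: closed_field_poly_normal => s /= char_s; rewrite {1}char_s.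
  by rewrite (monicP (char_poly_monic A)) scale1r.
have -> : char_poly A = char_poly (diag_mx (spectral_diag A)).
  by rewrite {1}A_eq char_poly_conj.
rewrite char_poly_trig; last exact/diag_mx_is_trig.
by rewrite big_map big_enum; apply: eq_bigr => i _; rewrite mxE eqxx.
Qed.

Lemma sum_norm_eigenvalues n (A : 'M[C]_n) : A \is normalmx ->
  \sum_(z <- eigenvalues A) `|z| = \sum_k `|spectral_diag A 0 k|.
Proof.
move=> An; rewrite (perm_big _ (perm_eigenvalues_spectral _ _ An))/=.
by rewrite big_map big_enum.
Qed.

(* [V] is the adjoint of a unitary polar factor of [B]. *)
Lemma exists_unitary_trace n (B : 'M[C]_n) : B \is normalmx ->
  exists2 V, V \is unitarymx &
    \tr (B *m V) = \sum_(z <- eigenvalues B) `|z|.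
Proof.
move=> Bn; have := Bn => /orthomx_spectralP.
set Q := spectralmx B; set d := spectral_diag B => B_eq.
have Qu : Q \is unitarymx := spectral_unitarymx B.
rewrite invmx_unitary// in B_eq.
(* Conjugate phases turn each eigenvalue into its modulus; a zero eigenvalue gets phase [1] so that
   [diag_mx s] stays unitary. *)
pose s := \row_k if d 0 k == 0 then 1 else (d 0 k)^* / `|d 0 k|.
have s1 k : `|s 0 k| = 1.
  rewrite mxE; case: eqVneq => [_|dk]; first by rewrite normr1.
  by rewrite normrM normfV norm_conjC normr_id divff ?normr_eq0.
exists (Q^t* *m diag_mx s *m Q).
  by rewrite !mul_unitarymx ?trmxC_unitary ?diag_mx_unitary.
rewrite sum_norm_eigenvalues// -/d B_eq !mulmxA mulmxtVK//.
rewrite mxtrace_mulC !mulmxA (unitarymxP Qu) mul1mx mul_diag_mx.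
apply: eq_bigr => k _; rewrite !mxE eqxx mulr1n.
case: eqVneq => [->|dk]; first by rewrite mul0r normr0.
by rewrite mulrA -normCK expr2 mulfK ?normr_eq0.
Qed.

(** The hypotheses on [P] make it a contraction. In a spectral basis of [A], the trace of
    [P *m A *m P^t* *m V] weights each eigenvalue of [A] by a diagonal entry of a contraction, of
    modulus at most 1. *)
Lemma sum_norm_eigenvalues_le m n (A : 'M[C]_n) (B : 'M[C]_m)
    (P : 'M[C]_(m, n)) (e : 'rV[C]_n) :
  A \is normalmx -> B \is normalmx ->
  P^t* *m P = diag_mx e -> (forall j, e 0 j <= 1) ->
  \sum_(z <- eigenvalues B) `|z| <= \sum_(z <- eigenvalues A) `|z|
    + \sum_i \sum_j `|(B - P *m A *m P^t*) i j|.
Proof.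
move=> An Bn PP e1; have [V Vu] := exists_unitary_trace _ _ Bn.
set nB := \sum_(z <- eigenvalues B) _ => tV.
have nB0 : 0 <= nB by rewrite sumr_ge0.
rewrite -(ger0_norm nB0) -tV.
have -> : B *m V = P *m A *m P^t* *m V + (B - P *m A *m P^t*) *m V.
  by rewrite -mulmxDl addrC subrK.
rewrite mxtraceD (le_trans (ler_normD _ _))// lerD//; last first.
  rewrite (le_trans (ler_norm_sum _ _ _))// ler_sum// => i _.
  rewrite mxE (le_trans (ler_norm_sum _ _ _))// ler_sum// => j _.
  by rewrite normrM ler_piMr// unitarymx_entry_le1.
rewrite sum_norm_eigenvalues//; have := An => /orthomx_spectralP.
set U := spectralmx A; set t := spectral_diag A => A_eq.
have Uu : U \is unitarymx := spectral_unitarymx A.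
rewrite invmx_unitary// in A_eq.
rewrite A_eq !mulmxA.
have -> : \tr (P *m U^t* *m diag_mx t *m U *m P^t* *m V)
   = \tr (diag_mx t *m (U *m P^t* *m V *m (P *m U^t*))).
  by rewrite -!mulmxA mxtrace_mulC -!mulmxA mxtrace_mulC -!mulmxA.
pose W := U *m P^t*.
have Wt : W^t* = P *m U^t* by rewrite /W trmx_mul map_mxM trmxCK.
rewrite -/W -Wt mul_diag_mx (le_trans (ler_norm_sum _ _ _))// ler_sum// => i _.
rewrite mxE normrM ler_piMr//.
(* [W *m W^t*] is [U *m diag_mx e *m U^t*], so its diagonal entries are averages of the [e 0 j] with
   weights summing to 1. *)
have W1 : \sum_j `|W i j| ^+ 2 <= 1.
  rewrite -diag_mul_trmxC Wt mulmxA /W -[U *m _ *m P]mulmxA PP.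
  rewrite -(unitarymx_row_norm _ _ U i Uu) mxE ler_sum// => j _.
  by rewrite mul_mx_diag !mxE mulrAC -normCK ler_piMr ?exprn_ge0.
have WV1 : \sum_j `|(W *m V) i j| ^+ 2 <= 1.
  by rewrite -diag_mul_trmxC trmx_mul map_mxM mulmxA mulmxtVK// diag_mul_trmxC.
(* In place of Cauchy-Schwarz, [2ab <= a^2 + b^2] is applied to each term of the [i]-th diagonal
   entry of [W *m V *m W^t*]; both sums of squares are at most 1. *)
have two : 0 < 2 :> C by rewrite ltr0n.
rewrite -(ler_pM2l two) mulr1 mxE.
rewrite (le_trans _ (lerD WV1 W1))// -big_split/=.
rewrite (le_trans (ler_wpM2l (ltW two) (ler_norm_sum _ _ _)))//.
rewrite mulr_sumr ler_sum// => j _.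
rewrite !mxE normrM norm_conjC mulr_natl.
by rewrite (real_leif_mean_square_scaled _ _).1// normr_real.
Qed.

End NuclearNorm.

(** * Counting the ordered pairs of vertices that span given edges *)

Section Counting.
Local Open Scope fset_scope.
Local Open Scope nat_scope.
Context {U : choiceType}.
Implicit Types (I : finType) (S : {fset {fset U}}).

Lemma sum_eq_op_le1 I (x : I -> U) a : injective x -> \sum_i (x i == a) <= 1.
Proof.
move=> x_inj; rewrite -big_mkcond sum1_card; apply/card_le1_eqP => i j.
by rewrite -!topredE => /eqP xi /eqP xj; apply: x_inj; rewrite xi xj.
Qed.

(** Unordered pairs agree in one of two orders. The products let the double sum over [x] and [y]
    factor. *)
Lemma fset2_eq_le (x y a b : U) :
  ([fset x; y] == [fset a; b]) <= (x == a) * (y == b) + (x == b) * (y == a).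
Proof.
case: eqP => // /fsetP E.
(* Testing membership of the four points leaves a statement about four booleans. *)
have := E x; have := E y; have := E a; have := E b; rewrite !inE !eqxx !orbT/=.
rewrite (eq_sym b x) (eq_sym b y) (eq_sym a x) (eq_sym a y).
by do 4 case: (_ == _).
Qed.

Lemma count_fset2_eq_le I (x : I -> U) (e : {fset U}) : injective x ->
  #|` e| = 2 -> \sum_i \sum_j ([fset x i; x j] == e) <= 2.
Proof.
move=> x_inj e2; have [a ae] : exists a, a \in e.
  by apply/fset0Pn; rewrite -cardfs_gt0 e2.
have /cardfs1P[b eb] : #|` e `\ a| == 1.
  by move: e2; rewrite (cardfsD1 a) ae add1n => -[->].
have -> : e = [fset a; b] by rewrite -eb fsetD1K.
have le1 c d : \sum_i \sum_j (x i == c) * (x j == d) <= 1.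
  under eq_bigr do rewrite -big_distrr/=.
  rewrite -big_distrl/=.
  exact: (leq_mul (sum_eq_op_le1 _ x c x_inj) (sum_eq_op_le1 _ x d x_inj)).
apply: leq_trans (leq_add (le1 a b) (le1 b a)).
rewrite -big_split leq_sum// => i _; rewrite -big_split leq_sum// => j _.
exact: fset2_eq_le.
Qed.

Lemma count_fset2_le S I (x : I -> U) : injective x ->
  (forall e, e \in S -> #|` e| = 2) ->
  \sum_i \sum_j ([fset x i; x j] \in S) <= 2 * #|` S|.
Proof.
move=> x_inj S2.
have -> : \sum_i \sum_j ([fset x i; x j] \in S)
    = \sum_(e <- S) \sum_i \sum_j ([fset x i; x j] == e).
  rewrite [RHS]exchange_big/=; apply: eq_bigr => i _.
  rewrite [RHS]exchange_big/=; apply: eq_bigr => j _.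
  (* [S] is enumerated without repetition, so membership is the number of members equal to the
     pair. *)
  rewrite -big_mkcond /= sum1_count -(count_uniq_mem _ (fset_uniq S)).
  by apply: eq_count => e /=; rewrite eq_sym.
rewrite card_fset_sum1 big_distrr/= big_seq [leqRHS]big_seq leq_sum// => e eS.
exact: count_fset2_eq_le (S2 e eS).
Qed.

End Counting.

(** * Comparison of the energies of two graphs *)

Section Energy.
Local Open Scope sesquilinear_scope.
Context {R : realType} {U : choiceType}.
Implicit Types G H : sgraph U.

Lemma energyE G : (energy R G)%:C%C
  = \sum_(z <- eigenvalues (adjacency R[i] G)) `|z|.
Proof.
by rewrite /energy rmorph_sum; apply: eq_bigr => z _; rewrite normc_def.
Qed.

Lemma adjacency_normal G : adjacency R[i] G \is normalmx.
Proof.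
apply: symmetric_normalmx; last first.
  by apply/mxOverP => i j; rewrite mxE realn.
by apply/is_hermitianmxP; apply/matrixP => i j; rewrite !mxE/= expr0 mul1r fsetUC.
Qed.

Definition edge_symdiff G H : {fset {fset U}} :=
  ((edges G `\` edges H) `|` (edges H `\` edges G))%fset.

Lemma edge_distE G H : edge_dist G H = #|` edge_symdiff G H|%:Z.
Proof.
have disj : ((edges G `\` edges H) `&` (edges H `\` edges G) = fset0)%fset.
  apply/fsetP => e; rewrite !inE.
  by case: (e \in edges G); case: (e \in edges H).
rewrite /edge_symdiff /edge_dist cardfsU disj cardfs0 subn0.
rewrite -(cardfsID (edges H) (edges G)) -(cardfsID (edges G) (edges H)).
rewrite [(edges H `&` _)%fset]fsetIC; lia.
Qed.

Lemma edge_distC G H : edge_dist G H = edge_dist H G.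
Proof. by rewrite /edge_dist fsetIC [X in X - _]addrC. Qed.

Let vertex G (i : 'I_#|{: vertices G}|) : U := val (enum_val i).

Let vertex_inj G : injective (vertex G).
Proof. by move=> i j /val_inj /enum_val_inj. Qed.

Let vertex_in G i : vertex G i \in vertices G.
Proof. exact: valP. Qed.

Let vertexP G u : reflect (exists i, vertex G i = u) (u \in vertices G).
Proof.
apply: (iffP idP) => [uG|[i <-]//].
by exists (enum_rank [` uG]%fset); rewrite /vertex enum_rankK.
Qed.

(** With the next lemma, this evaluates a product with a row of [mxvertex]: a Kronecker delta at a
    vertex of [G], zero at any other point. *)
Let sum_vertex G (f : 'I_#|{: vertices G}| -> R[i]) i :
  \sum_k (vertex G i == vertex G k)%:R * f k = f i.
Proof.
rewrite (bigD1 i)//= eqxx mul1r big1 ?addr0// => k ki.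
by rewrite (inj_eq (vertex_inj G)) eq_sym (negbTE ki) mul0r.
Qed.

Let sum_notin_vertex G (f : 'I_#|{: vertices G}| -> R[i]) u :
  u \notin vertices G -> \sum_k (u == vertex G k)%:R * f k = 0.
Proof.
move=> uG; rewrite big1// => k _; case: eqP => [uk|_]; last by rewrite mul0r.
by rewrite uk vertex_in in uG.
Qed.

Let mxvertex H G : 'M[R[i]]_(_, _) :=
  \matrix_(i, j) (vertex H i == vertex G j)%:R.

Let mxvertex_trmxC H G : (mxvertex H G)^t* = mxvertex G H.
Proof. by apply/matrixP => i j; rewrite !mxE conjC_nat eq_sym. Qed.

(** The Gram matrix is the projection onto the shared vertices, which gives the contraction
    hypothesis of [sum_norm_eigenvalues_le]. *)
Let mxvertex_mul H G : (mxvertex H G)^t* *m mxvertex H G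
  = diag_mx (\row_j (vertex G j \in vertices H)%:R).
Proof.
rewrite mxvertex_trmxC; apply/matrixP => i j; rewrite !mxE.
under eq_bigr do rewrite !mxE.
case: (vertexP H (vertex G i)) => [[k ki]|/vertexP iH].
  by rewrite -ki sum_vertex ki (inj_eq (vertex_inj G)).
by rewrite mul0rn sum_notin_vertex.
Qed.

Let mxvertex_adjacency H G i j :
  (mxvertex H G *m adjacency R[i] G *m (mxvertex H G)^t*) i j
  = ([fset vertex H i; vertex H j]%fset \in edges G)%:R.
Proof.
(* Outside [vertices G] the product vanishes; the right side does too, since edges of [G] join
   vertices of [G]. *)
have edgeN u v : (u \notin vertices G) || (v \notin vertices G) ->
    ([fset u; v]%fset \in edges G) = false.
  rewrite -negb_and; apply: contraNF => /edges_subset.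
  by rewrite fsubUset !fsub1set.
rewrite -mulmxA mxE; under eq_bigr do rewrite mxE.
case: (vertexP G (vertex H i)) => [[k ki]|/vertexP iG]; last first.
  by rewrite sum_notin_vertex// edgeN ?iG.
rewrite -ki sum_vertex mxE mxvertex_trmxC.
under eq_bigr do rewrite !mxE mulrC eq_sym.
case: (vertexP G (vertex H j)) => [[l lj]|/vertexP jG]; last first.
  by rewrite sum_notin_vertex// edgeN ?jG ?orbT.
by rewrite -lj sum_vertex.
Qed.

Lemma energy_le G H : energy R H <= energy R G + 2 * (edge_dist G H)%:~R.
Proof.
suff : (energy R H)%:C%C <= (energy R G + 2 * (edge_dist G H)%:~R)%:C%C.
  by rewrite lecR.
rewrite rmorphD/= !energyE.
apply: le_trans (sum_norm_eigenvalues_le _ _ _ _ (mxvertex H G) _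
  (adjacency_normal G) (adjacency_normal H) (mxvertex_mul H G) _) _.
  by move=> j; rewrite mxE; case: (_ \in _); rewrite ?ler01.
rewrite lerD2l edge_distE.
have -> : (2 * (#|` edge_symdiff G H|%:Z)%:~R)%:C%C
  = (2 * #|` edge_symdiff G H|)%:R :> R[i].
  by rewrite -pmulrn -natrM rmorph_nat.
apply: (@le_trans _ _
  (\sum_i \sum_j ([fset vertex H i; vertex H j]%fset \in edge_symdiff G H))%:R).
  rewrite natr_sum ler_sum// => i _; rewrite natr_sum ler_sum// => j _.
  (* An entry of the difference is 0, 1 or -1, and nonzero exactly when the pair is an edge of just
     one graph. *)
  rewrite mxE [X in _ + X]mxE mxvertex_adjacency mxE !inE.
  by do 2!case: (_ \in _); rewrite ?subrr ?subr0 ?sub0r ?normrN ?normr0 ?normr1.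
rewrite ler_nat; apply: count_fset2_le (vertex_inj H) _ => f.
by rewrite !inE => /orP[] /andP[_]; apply: edges_card2.
Qed.

End Energy.

Theorem theorem2p4 (R : realType) (U : choiceType) (G H : nat -> sgraph U)
    (G_energy_pos : \forall n \near \oo, 0 < energy R (G n))
    (dist_small :
      (fun n : nat => (edge_dist (G n) (H n))%:~R / energy R (G n)) @ \oo
        --> (0 : R)) :
  (fun n : nat => energy R (H n) / energy R (G n)) @ \oo --> (1 : R).
Proof.
pose q n : R := (edge_dist (G n) (H n))%:~R / energy R (G n).
have lim c : (fun n => 1 + c * q n) @ \oo --> (1 : R).
  rewrite -[in X in _ --> X](addr0 1) -[in X in _ --> X](mulr0 c).
  by apply: cvgD; [exact: cvg_cst | apply: cvgMr; exact: dist_small].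
(* The ratio of the energies differs from 1 by at most [2 * q n] once [energy R (G n)] is
   positive. *)
apply: (@squeeze_cvgr _ _ _ _ (fun n => 1 + - 2 * q n) (fun n => 1 + 2 * q n));
  [|exact: lim|exact: lim].
near=> n; have E0 : 0 < energy R (G n) by near: n.
have qE : q n * energy R (G n) = (edge_dist (G n) (H n))%:~R.
  by rewrite divfK// gt_eqF.
rewrite ler_pdivlMr// ler_pdivrMr//.
rewrite (mulrDl 1 (2 * q n)) (mulrDl 1 (-2 * q n)) !mul1r -!(mulrA _ (q n)) qE.
(* The first [energy_le] gives the upper bound; the second, with the graphs exchanged, gives the
   lower one. *)
by rewrite energy_le andbT mulNr lerBlDr edge_distC energy_le.
Unshelve. all: by end_near.
Qed.
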